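(* Let $\mathcal{C}$ and $\mathcal{C}'$ be Krull-Schmidt algebraic 2-Calabi-Yau triangulated categories with cluster-tilting subcategories $\mathcal{T}$ and $\mathcal{T}'$, respectively. Assume that $\mathcal{T}$ and $\mathcal{T}'$ are directed and equivalent. Then there is a map $F\colon\operatorname{Ob}\mathcal{C}\to\operatorname{Ob}\mathcal{C}'$ satisfying the following properties: (1) $F$ induces a bijection on isomorphism classes of objects, (2) $F$ induces a bijection on cluster-tilting subcategories, (3) $F$ respects mutations.
   Context: $k$ is an algebraically closed field; all categories and functors are $k$-linear and essentially small. A Hom-finite additive category is Krull-Schmidt iff idempotents split. A triangulated category is 2-Calabi-Yau if it is Hom-finite and has a Serre functor $\mathbb{S}$ with $\mathbb{S}\cong[2]$ as triangle functors; it is algebraic if it is triangle equivalent to the stable category of a Frobenius exact category. $\operatorname{ind}$ denotes a set of representatives of isomorphism classes of indecomposables. $\operatorname{Ext}^1(X,Y)=\operatorname{Hom}(X,Y[1])$. A full subcategory $\mathcal{T}\subseteq\mathcal{C}$ is functorially finite if every object of $\mathcal{C}$ has a right and a left $\mathcal{T}$-approximation (right: a map $T_0\to X$ with $T_0\in\mathcal{T}$ through which every map from an object of $\mathcal{T}$ to $X$ factors; left: dual). A cluster-tilting subcategory is a functorially finite full subcategory $\mathcal{T}$ with $\mathcal{T}=\{X\mid\operatorname{Ext}^1(\mathcal{T},X)=0\}=\{X\mid\operatorname{Ext}^1(X,\mathcal{T})=0\}$. A cycle in a Krull-Schmidt category is a sequence $X_0,\dots,X_n$ ($n\ge1$) of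 indecomposables with $X_0\cong X_n$ and a nonzero noninvertible morphism $X_i\to X_{i+1}$ for each $0\le i<n$; the category is directed if it has no cycles. Mutation: for a cluster-tilting subcategory $\mathcal{U}$ of a Krull-Schmidt 2-Calabi-Yau category and $X\in\operatorname{ind}\mathcal{U}$, there is exactly one cluster-tilting subcategory $\mathcal{V}\ne\mathcal{U}$ containing $\operatorname{add}(\operatorname{ind}\mathcal{U}\setminus\{X\})$ (Iyama-Yoshino); $\mathcal{V}$ is called the mutation of $\mathcal{U}$ at $X$. For a cluster-tilting subcategory $\mathcal{U}\subseteq\mathcal{C}$, $F(\mathcal{U})$ denotes the full subcategory of $\mathcal{C}'$ of all objects isomorphic to some $F(U)$, $U\in\mathcal{U}$; (2) means that $\mathcal{U}\mapsto F(\mathcal{U})$ is a bijection between the cluster-tilting subcategories of $\mathcal{C}$ and those of $\mathcal{C}'$. ''Respects mutations'' means: if $\mathcal{V}$ is the mutation of $\mathcal{U}$ at an indecomposable object $X\in\mathcal{U}$, then $F(\mathcal{V})$ is the mutation of $F(\mathcal{U})$ at $F(X)$. *)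

(* Defs.v *)
From HB Require Import structures.
From mathcomp Require Import all_boot all_algebra.
From mathcomp Require Import boolp classical_sets functions.

Set Implicit Arguments.
Unset Strict Implicit.
Unset Printing Implicit Defensive.

Import GRing.Theory.
Local Open Scope ring_scope.
Local Open Scope classical_set_scope.

#[local] Obligation Tactic := idtac.

Reserved Notation "g \oc f" (at level 40, left associativity).

(* The collection of objects is a type, so every [category k] is small relative
   to some universe. *)
Record category (k : fieldType) := Category {
  ob :> Type;
  hom : ob -> ob -> lmodType k;
  idm : forall X, hom X X;
  comp : forall X Y Z, hom Y Z -> hom X Y -> hom X Z;
  comp1m : forall X Y (f : hom X Y), comp (idm Y) f = f;
  compm1 : forall X Y (f : hom X Y), comp f (idm X) = f;
  compA : forall X Y Z W (h : hom Z W) (g : hom Y Z) (f : hom X Y),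
    comp h (comp g f) = comp (comp h g) f;
  comp_linear_l : forall X Y Z (f : hom X Y),
    linear (fun g : hom Y Z => comp g f);
  comp_linear_r : forall X Y Z (g : hom Y Z),
    linear (fun f : hom X Y => comp g f)
}.

Arguments hom {k c} _ _.
Arguments idm {k c} X.
Arguments comp {k c X Y Z} _ _.
Notation "g \oc f" := (comp g f) : ring_scope.

Section CompositionLemmas.
Variables (k : fieldType) (C : category k).
Implicit Types X Y Z : C.

Lemma compDl X Y Z (g g' : hom Y Z) (f : hom X Y) :
  (g + g') \oc f = g \oc f + g' \oc f.
Proof. by have := comp_linear_l f 1 g g'; rewrite /= !scale1r. Qed.

Lemma compDr X Y Z (g : hom Y Z) (f f' : hom X Y) :
  g \oc (f + f') = g \oc f + g \oc f'.
Proof. by have := comp_linear_r g 1 f f'; rewrite /= !scale1r. Qed.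

Lemma comp0m X Y Z (f : hom X Y) : (0 : hom Y Z) \oc f = 0.
Proof. by apply: (addrI (0 \oc f)); rewrite -compDl !addr0. Qed.

Lemma compm0 X Y Z (g : hom Y Z) : g \oc (0 : hom X Y) = 0.
Proof. by apply: (addrI (g \oc 0)); rewrite -compDr !addr0. Qed.

Lemma compZl a X Y Z (g : hom Y Z) (f : hom X Y) :
  (a *: g) \oc f = a *: (g \oc f).
Proof. by have := comp_linear_l f a g 0; rewrite /= comp0m !addr0. Qed.

Lemma compZr a X Y Z (g : hom Y Z) (f : hom X Y) :
  g \oc (a *: f) = a *: (g \oc f).
Proof. by have := comp_linear_r g a f 0; rewrite /= compm0 !addr0. Qed.

Lemma compNl X Y Z (g : hom Y Z) (f : hom X Y) : (- g) \oc f = - (g \oc f).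
Proof. by rewrite -scaleN1r compZl scaleN1r. Qed.

Lemma compNr X Y Z (g : hom Y Z) (f : hom X Y) : g \oc (- f) = - (g \oc f).
Proof. by rewrite -scaleN1r compZr scaleN1r. Qed.

Lemma compBl X Y Z (g g' : hom Y Z) (f : hom X Y) :
  (g - g') \oc f = g \oc f - g' \oc f.
Proof. by rewrite compDl compNl. Qed.

Lemma compBr X Y Z (g : hom Y Z) (f f' : hom X Y) :
  g \oc (f - f') = g \oc f - g \oc f'.
Proof. by rewrite compDr compNr. Qed.

End CompositionLemmas.

Section Objects.
Variables (k : fieldType) (C : category k).
Implicit Types X Y Z : C.

Definition is_iso X Y (f : hom X Y) :=
  exists g : hom Y X, g \oc f = idm X /\ f \oc g = idm Y.

Definition isomorphic X Y := exists f : hom X Y, is_iso f.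

Definition is_zero X := idm X = 0.

(* Direct sums (biproducts) of finite families; the empty family gives the zero
   objects. *)
Definition is_dsum n (A : 'I_n -> C) X :=
  exists (i : forall j, hom (A j) X) (p : forall j, hom X (A j)),
    [/\ forall j, p j \oc i j = idm (A j),
        forall j l, j != l -> p j \oc i l = 0
      & \sum_j (i j \oc p j) = idm X].

Definition additive_category := forall n (A : 'I_n -> C), exists X, is_dsum A X.

Definition is_summand X Y :=
  exists (i : hom X Y) (p : hom Y X), p \oc i = idm X.

Definition indecomposable X :=
  ~ is_zero X /\
  forall A : 'I_2 -> C, is_dsum A X -> exists j, is_zero (A j).

(* The non-units of the ring [End X], which is nonzero, are closed under
   addition. *)
Definition local_end X :=
  ~ is_zero X /\
  forall f g : hom X X, is_iso (f + g) -> is_iso f \/ is_iso g.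

Definition krull_schmidt :=
  additive_category /\
  forall X, exists n (A : 'I_n -> C), is_dsum A X /\ forall j, local_end (A j).

Definition hom_finite :=
  forall X Y, exists n (b : 'I_n -> hom X Y),
    forall f, exists c : 'I_n -> k, f = \sum_j c j *: b j.

Definition is_cycle n (s : nat -> C) :=
  [/\ (0 < n)%N,
      forall j, (j <= n)%N -> indecomposable (s j),
      isomorphic (s 0%N) (s n)
    & forall j, (j < n)%N ->
        exists f : hom (s j) (s j.+1), f <> 0 /\ ~ is_iso f].

Definition directed := ~ exists n s, is_cycle n s.

(* The closure of [S] under isomorphisms, finite direct sums and direct
   summands. *)
Definition add_closure (S : set C) : set C :=
  [set X | exists n (A : 'I_n -> C) Y,
     [/\ forall j, S (A j), is_dsum A Y & is_summand X Y]].

Definition is_right_approximation (T : set C) X T0 (f : hom T0 X) :=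
  T T0 /\ forall T1 (g : hom T1 X), T T1 -> exists h, g = f \oc h.

Definition is_left_approximation (T : set C) X T0 (f : hom X T0) :=
  T T0 /\ forall T1 (g : hom X T1), T T1 -> exists h, g = h \oc f.

Definition functorially_finite (T : set C) :=
  forall X, (exists T0 (f : hom T0 X), is_right_approximation T f) /\
            (exists T0 (f : hom X T0), is_left_approximation T f).

Definition is_kernel X Y Z (i : hom X Y) (p : hom Y Z) :=
  p \oc i = 0 /\
  forall W (f : hom W Y), p \oc f = 0 -> exists! g : hom W X, i \oc g = f.

Definition is_cokernel X Y Z (p : hom Y Z) (i : hom X Y) :=
  p \oc i = 0 /\
  forall W (f : hom Y W), f \oc i = 0 -> exists! g : hom Z W, g \oc p = f.

Definition is_pushout X Y X' Y' (i : hom X Y) (f : hom X X')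
    (i' : hom X' Y') (f' : hom Y Y') :=
  f' \oc i = i' \oc f /\
  forall W (a : hom Y W) (b : hom X' W), a \oc i = b \oc f ->
    exists! c : hom Y' W, c \oc f' = a /\ c \oc i' = b.

Definition is_pullback Y Z Y' Z' (p : hom Y Z) (f : hom Z' Z)
    (p' : hom Y' Z') (f' : hom Y' Y) :=
  p \oc f' = f \oc p' /\
  forall W (a : hom W Y) (b : hom W Z'), p \oc a = f \oc b ->
    exists! c : hom W Y', f' \oc c = a /\ p' \oc c = b.

End Objects.

Arguments krull_schmidt {k} C.
Arguments hom_finite {k} C.
Arguments directed {k} C.
Arguments additive_category {k} C.

Section FullSubcategory.
Variables (k : fieldType) (C : category k) (T : set C).

Definition full_sub : category k :=
  @Category k {X : C | T X} (fun X Y => hom (sval X) (sval Y))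
    (fun X => idm (sval X)) (fun X Y Z g f => g \oc f)
    (fun X Y f => comp1m f) (fun X Y f => compm1 f)
    (fun X Y Z W h g f => compA h g f)
    (fun X Y Z f => comp_linear_l f) (fun X Y Z g => comp_linear_r g).

End FullSubcategory.

Record functor (k : fieldType) (C D : category k) := Functor {
  fob :> C -> D;
  fmap : forall X Y : C, hom X Y -> hom (fob X) (fob Y);
  fmap_linear : forall X Y : C, linear (@fmap X Y);
  fmap1 : forall X : C, fmap (idm X) = idm (fob X);
  fmapM : forall (X Y Z : C) (g : hom Y Z) (f : hom X Y),
    fmap (g \oc f) = fmap g \oc fmap f
}.

Arguments fmap {k C D} _ {X Y} _.

Section Functors.
Variable k : fieldType.
Implicit Types C D E : category k.

Program Definition comp_functor C D E (G : functor D E) (F : functor C D) :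
    functor C E :=
  @Functor k C E (fun X => G (F X)) (fun X Y f => fmap G (fmap F f)) _ _ _.
Next Obligation. by move=> C D E G F X Y a f g /=; rewrite !fmap_linear. Qed.
Next Obligation. by move=> C D E G F X /=; rewrite !fmap1. Qed.
Next Obligation. by move=> C D E G F X Y Z g f /=; rewrite !fmapM. Qed.

Definition is_equivalence C D (F : functor C D) :=
  (forall X Y (g : hom (F X) (F Y)), exists! f : hom X Y, fmap F f = g) /\
  (forall Y, exists X, isomorphic (F X) Y).

Definition equivalent C D := exists F : functor C D, is_equivalence F.

Definition nat_iso C D (F G : functor C D) (t : forall X, hom (F X) (G X)) :=
  (forall X, is_iso (t X)) /\
  (forall X Y (f : hom X Y), fmap G f \oc t X = t Y \oc fmap F f).

End Functors.

(* Structure without axioms: the stable category of a Frobenius exact category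
   is first constructed at this level, and triangle functors only depend on
   it. *)
Record pretriangulated (k : fieldType) := Pretriangulated {
  tcat :> category k;
  shift : functor tcat tcat;
  dist : forall X Y Z : tcat,
    hom X Y -> hom Y Z -> hom Z (shift X) -> Prop
}.

Arguments shift {k p}.
Arguments dist {k p X Y Z} _ _ _.

Section Triangulated.
Variables (k : fieldType) (C : pretriangulated k).

Definition dist_iso_closed :=
  forall (X Y Z X' Y' Z' : C)
    (u : hom X Y) (v : hom Y Z) (w : hom Z (shift X))
    (u' : hom X' Y') (v' : hom Y' Z') (w' : hom Z' (shift X'))
    (a : hom X X') (b : hom Y Y') (c : hom Z Z'),
  is_iso a -> is_iso b -> is_iso c ->
  b \oc u = u' \oc a -> c \oc v = v' \oc b -> fmap shift a \oc w = w' \oc c ->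
  dist u v w -> dist u' v' w'.

Definition dist_identity :=
  forall X Z : C, is_zero Z ->
  dist (idm X) (0 : hom X Z) (0 : hom Z (shift X)).

Definition dist_cone :=
  forall (X Y : C) (u : hom X Y),
  exists Z (v : hom Y Z) (w : hom Z (shift X)), dist u v w.

Definition dist_rotation :=
  forall (X Y Z : C) (u : hom X Y) (v : hom Y Z) (w : hom Z (shift X)),
  dist u v w <-> dist v w (- fmap shift u).

Definition dist_morphism :=
  forall (X Y Z X' Y' Z' : C)
    (u : hom X Y) (v : hom Y Z) (w : hom Z (shift X))
    (u' : hom X' Y') (v' : hom Y' Z') (w' : hom Z' (shift X'))
    (a : hom X X') (b : hom Y Y'),
  dist u v w -> dist u' v' w' -> b \oc u = u' \oc a ->
  exists c : hom Z Z', c \oc v = v' \oc b /\ fmap shift a \oc w = w' \oc c.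

Definition dist_octahedral :=
  forall (X Y Z X' Y' Z' : C) (f : hom X Y) (g : hom Y Z)
    (a : hom Y Z') (b : hom Z' (shift X))
    (c : hom Z X') (d : hom X' (shift Y))
    (e : hom Z Y') (h : hom Y' (shift X)),
  dist f a b -> dist g c d -> dist (g \oc f) e h ->
  exists (u : hom Z' Y') (v : hom Y' X'),
    dist u v (fmap shift a \oc d) /\
    [/\ u \oc a = e \oc g, h \oc u = b, v \oc e = c
      & d \oc v = fmap shift f \oc h].

Record is_triangulated : Prop := IsTriangulated {
  tr_additive : additive_category C;
  tr_shift : is_equivalence (shift : functor C C);
  tr_iso : dist_iso_closed;
  tr_identity : dist_identity;
  tr_cone : dist_cone;
  tr_rotation : dist_rotation;
  tr_morphism : dist_morphism;
  tr_octahedral : dist_octahedral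
}.

End Triangulated.

Record triangulated (k : fieldType) := Triangulated {
  tri_data :> pretriangulated k;
  tri_axioms : is_triangulated tri_data
}.

Section TriangleFunctors.
Variable k : fieldType.
Implicit Types C D : pretriangulated k.

(* A triangle functor is a functor [F] together with the isomorphism [phi]
   commuting it with the shifts. *)
Definition shift_comm C D (F : functor C D) :=
  forall X, hom (F (shift X)) (shift (F X)).

Definition nat_shift_comm C D (F : functor C D) (phi : shift_comm F) :=
  nat_iso (F := comp_functor F shift) (G := comp_functor shift F) phi.

Definition triangle_functor C D (F : functor C D) (phi : shift_comm F) :=
  nat_shift_comm phi /\
  forall (X Y Z : C) (u : hom X Y) (v : hom Y Z) (w : hom Z (shift X)),
    dist u v w -> dist (fmap F u) (fmap F v) (phi X \oc fmap F w).

Definition triangle_equivalent C D :=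
  exists (F : functor C D) (phi : shift_comm F),
    triangle_functor phi /\ is_equivalence F.

Definition triangle_iso C D (F G : functor C D)
    (phi : shift_comm F) (psi : shift_comm G) :=
  exists t : forall X, hom (F X) (G X),
    nat_iso t /\
    forall X, psi X \oc t (shift X) = fmap shift (t X) \oc phi X.

End TriangleFunctors.

Section CalabiYau.
Variables (k : fieldType) (C : triangulated k).

Definition pairing (S : functor C C) :=
  forall X Y : C, hom X Y -> {linear hom Y (S X) -> k^o}.

(* [eta] is a natural isomorphism Hom(X, Y) -> D Hom(Y, S X), where D is the
   k-linear dual. *)
Record is_serre_functor (S : functor C C) (eta : pairing S) : Prop :=
  IsSerreFunctor {
    serre_equivalence : is_equivalence S;
    serre_linear : forall X Y a (f g : hom X Y) h,
      eta X Y (a *: f + g) h = a * eta X Y f h + eta X Y g h;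
    serre_bijective : forall X Y (l : {linear hom Y (S X) -> k^o}),
      exists! f : hom X Y, forall h, eta X Y f h = l h;
    serre_natural_l : forall X X' Y (a : hom X' X) (f : hom X Y) h,
      eta X' Y (f \oc a) h = eta X Y f (fmap S a \oc h);
    serre_natural_r : forall X Y Y' (b : hom Y Y') (f : hom X Y) h,
      eta X Y' (b \oc f) h = eta X Y f (h \oc b)
  }.

(* A Serre functor of a triangulated category is a triangle functor in a
   canonical way (Bondal-Kapranov, Van den Bergh): its commutation with the shift
   is the unique [sigma] for which the trace forms
   Tr_X = eta_{X,X}(id) : Hom(X, S X) -> k satisfy
   Tr_{X[1]}(sigma^-1 o h[1]) = - Tr_X(h).
   Without the sign, (S, sigma) would not preserve distinguished triangles. *)
Definition serre_shift_comm (S : functor C C) (eta : pairing S)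
    (sigma : shift_comm S) :=
  nat_shift_comm sigma /\
  forall (X Y : C) (f : hom X Y) (h : hom Y (S X))
      (h' : hom (shift Y) (S (shift X))),
    sigma X \oc h' = fmap shift h ->
    eta (shift X) (shift Y) (fmap shift f) h' = - eta X Y f h.

Definition shift2 : functor C C := comp_functor shift shift.

(* As a triangle functor, [n] carries the commutation (-1)^n. *)
Definition shift2_comm : shift_comm shift2 := fun X => idm _.

Definition calabi_yau2 :=
  hom_finite C /\
  exists (S : functor C C) (eta : pairing S) (sigma : shift_comm S),
    [/\ is_serre_functor eta, serre_shift_comm eta sigma
      & triangle_iso sigma shift2_comm].

End CalabiYau.

Arguments calabi_yau2 {k} C.

Record exact_data (k : fieldType) := ExactData {
  ecat :> category k;
  conflation : forall X Y Z : ecat, hom X Y -> hom Y Z -> Prop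
}.

Arguments conflation {k e X Y Z} _ _.

Section Exact.
Variables (k : fieldType) (E : exact_data k).
Implicit Types X Y Z W : E.

Definition inflation X Y (i : hom X Y) :=
  exists Z (p : hom Y Z), conflation i p.

Definition deflation Y Z (p : hom Y Z) :=
  exists X (i : hom X Y), conflation i p.

Record is_exact : Prop := IsExact {
  ex_additive : additive_category E;
  ex_kernel : forall X Y Z (i : hom X Y) (p : hom Y Z),
    conflation i p -> is_kernel i p /\ is_cokernel p i;
  ex_iso : forall X Y Z X' Y' Z' (i : hom X Y) (p : hom Y Z)
      (i' : hom X' Y') (p' : hom Y' Z')
      (a : hom X X') (b : hom Y Y') (c : hom Z Z'),
    is_iso a -> is_iso b -> is_iso c ->
    b \oc i = i' \oc a -> c \oc p = p' \oc b ->
    conflation i p -> conflation i' p';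
  ex_inflation1 : forall X, inflation (idm X);
  ex_deflation1 : forall X, deflation (idm X);
  ex_inflationM : forall X Y Z (j : hom Y Z) (i : hom X Y),
    inflation j -> inflation i -> inflation (j \oc i);
  ex_deflationM : forall X Y Z (q : hom Y Z) (p : hom X Y),
    deflation q -> deflation p -> deflation (q \oc p);
  ex_pushout : forall X Y X' (i : hom X Y) (f : hom X X'), inflation i ->
    exists Y' (i' : hom X' Y') (f' : hom Y Y'),
      is_pushout i f i' f' /\ inflation i';
  ex_pullback : forall Y Z Z' (p : hom Y Z) (f : hom Z' Z), deflation p ->
    exists Y' (p' : hom Y' Z') (f' : hom Y' Y),
      is_pullback p f p' f' /\ deflation p'
}.

Definition projective P :=
  forall Y Z (p : hom Y Z) (f : hom P Z), deflation p ->
  exists g : hom P Y, p \oc g = f.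

Definition injective_ob I :=
  forall X Y (i : hom X Y) (f : hom X I), inflation i ->
  exists g : hom Y I, g \oc i = f.

Record is_frobenius : Prop := IsFrobenius {
  fr_exact : is_exact;
  fr_projectives : forall X, exists P (p : hom P X), projective P /\ deflation p;
  fr_injectives : forall X, exists I (i : hom X I), injective_ob I /\ inflation i;
  fr_proj_inj : forall X, projective X <-> injective_ob X
}.

End Exact.

Record frobenius (k : fieldType) := Frobenius {
  fr_data :> exact_data k;
  fr_axioms : is_frobenius fr_data
}.

Section QuotientModule.
Variables (k : fieldType) (V : lmodType k) (I : {pred V}).
Variable submodI : submod_closed I.
Local Open Scope quotient_scope.

Definition submod_of & submod_closed I : {pred V} := I.
HB.instance Definition _ :=
  GRing.isSubmodClosed.Build k V (submod_of submodI) submodI.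

Definition quotmod := Quotient.quot (submod_of submodI).
HB.instance Definition _ := GRing.Zmodule.on quotmod.

Definition qpi (v : V) : quotmod := \pi_(Quotient.quot (submod_of submodI)) v.
Definition qrepr (q : quotmod) : V := repr (q : Quotient.quot (submod_of submodI)).

Lemma qreprK q : qpi (qrepr q) = q.
Proof. exact: reprK. Qed.

Lemma qpi_eq u v : qpi u = qpi v <-> u - v \in I.
Proof.
split=> [/eqP|uv]; first by rewrite /qpi -Quotient.idealrBE.
by apply/eqP; rewrite /qpi -Quotient.idealrBE.
Qed.

Lemma qpiD u v : qpi (u + v) = qpi u + qpi v.
Proof. by rewrite /qpi !piE. Qed.

Definition qscale a (q : quotmod) := qpi (a *: qrepr q).

Lemma qpiZ a v : qpi (a *: v) = qscale a (qpi v).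
Proof.
apply/qpi_eq; rewrite -scalerBr; apply: (@rpredZ _ _ (submod_of submodI)).
by apply/qpi_eq; rewrite qreprK.
Qed.

Fact qscaleA a b q : qscale a (qscale b q) = qscale (a * b) q.
Proof. by rewrite -[q]qreprK -!qpiZ scalerA. Qed.

Fact qscale1 : left_id 1 qscale.
Proof. by move=> q; rewrite -[q]qreprK -!qpiZ scale1r. Qed.

Fact qscaleDr : right_distributive qscale +%R.
Proof.
move=> a p q; rewrite -[p]qreprK -[q]qreprK.
by rewrite -qpiD -!qpiZ -qpiD scalerDr.
Qed.

Fact qscaleDl q : {morph qscale^~ q : a b / a + b}.
Proof. by move=> a b /=; rewrite -[q]qreprK -!qpiZ -qpiD scalerDl. Qed.

HB.instance Definition _ :=
  GRing.Zmodule_isLmodule.Build k quotmod qscaleA qscale1 qscaleDr qscaleDl.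

Lemma qpi_linear : linear qpi.
Proof. by move=> a u v; rewrite qpiD qpiZ. Qed.

End QuotientModule.

Section Stable.
Variables (k : fieldType) (E : frobenius k).
Implicit Types X Y Z W : E.

Definition factors_proj X Y : {pred hom X Y} :=
  fun f => `[< exists P (b : hom P Y) (a : hom X P),
                 projective P /\ f = b \oc a >].

Lemma factors_projP X Y (f : hom X Y) :
  reflect (exists P (b : hom P Y) (a : hom X P), projective P /\ f = b \oc a)
    (f \in @factors_proj X Y).
Proof. exact: asboolP. Qed.

Lemma dsum_projective n (A : 'I_n -> E) P :
  is_dsum A P -> (forall j, projective (A j)) -> projective P.
Proof.
move=> [i [p [_ _ sum1]]] projA Y Z q f dq.
have /all_sig[g gP] j : {g : hom (A j) Y | q \oc g = f \oc i j}.
  by apply: cid; exact: projA dq.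
exists (\sum_j g j \oc p j).
transitivity (f \oc \sum_j (i j \oc p j)); last by rewrite sum1 compm1.
rewrite (big_morph (comp q) (compDr q) (compm0 _ q)).
rewrite (big_morph (comp f) (compDr f) (compm0 _ f)).
by apply: eq_bigr => j _; rewrite !compA gP.
Qed.

Lemma exists_projective : exists P : E, projective P.
Proof.
have add := ex_additive (fr_exact (fr_axioms E)).
have [P dP] := add 0%N (fun j : 'I_0 => False_rect E (notF (ltn_ord j))).
by exists P; apply: dsum_projective dP _ => -[].
Qed.

Fact factors_proj_submod X Y : submod_closed (@factors_proj X Y).
Proof.
split=> [|c f g].
  have [P projP] := exists_projective.
  by apply/factors_projP; exists P, 0, 0; split=> //; rewrite comp0m.
move=> /factors_projP[P [b [a [pP ->]]]] /factors_projP[Q [d [e [pQ ->]]]].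
have add := ex_additive (fr_exact (fr_axioms E)).
pose A (j : 'I_2) : E := if j == ord0 then P else Q.
have [S dS] := add _ A; have [i [p [pi pi0 _]]] := dS.
have projS : projective S.
  by apply: dsum_projective dS _ => j; rewrite /A; case: (j == _).
pose iP : hom P S := i ord0; pose pP' : hom S P := p ord0.
pose iQ : hom Q S := i ord_max; pose pQ' : hom S Q := p ord_max.
have PP : pP' \oc iP = idm P by exact: (pi ord0).
have QQ : pQ' \oc iQ = idm Q by exact: (pi ord_max).
have PQ : pP' \oc iQ = 0 by exact: (pi0 ord0 ord_max).
have QP : pQ' \oc iP = 0 by exact: (pi0 ord_max ord0).
apply/factors_projP.
exists S, (c *: (b \oc pP') + d \oc pQ'), (iP \oc a + iQ \oc e); split=> //.
rewrite !compDl !compDr !compZl -!compA.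
rewrite ![pP' \oc (_ \oc _)]compA ![pQ' \oc (_ \oc _)]compA.
by rewrite PP PQ QP QQ !comp0m !comp1m !compm0 scaler0 addr0 add0r.
Qed.

Lemma factors_proj_l X Y Z (g : hom Y Z) (f : hom X Y) :
  g \in @factors_proj Y Z -> g \oc f \in @factors_proj X Z.
Proof.
move=> /factors_projP[P [b [a [pP ->]]]].
by apply/factors_projP; exists P, b, (a \oc f); rewrite compA.
Qed.

Lemma factors_proj_r X Y Z (g : hom Y Z) (f : hom X Y) :
  f \in @factors_proj X Y -> g \oc f \in @factors_proj X Z.
Proof.
move=> /factors_projP[P [b [a [pP ->]]]].
by apply/factors_projP; exists P, (g \oc b), a; rewrite compA.
Qed.

Definition shom X Y : lmodType k := quotmod (factors_proj_submod X Y).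

Definition spi X Y (f : hom X Y) : shom X Y := qpi (factors_proj_submod X Y) f.

Definition srepr X Y (q : shom X Y) : hom X Y := qrepr q.

Lemma sreprK X Y (q : shom X Y) : spi (srepr q) = q.
Proof. exact: qreprK. Qed.

Lemma spi_eq X Y (f g : hom X Y) :
  spi f = spi g <-> f - g \in @factors_proj X Y.
Proof. exact: qpi_eq. Qed.

Lemma spi_linear X Y : linear (@spi X Y).
Proof. exact: qpi_linear. Qed.

Definition scomp X Y Z (q : shom Y Z) (r : shom X Y) : shom X Z :=
  spi (srepr q \oc srepr r).

Lemma scompE X Y Z (g : hom Y Z) (f : hom X Y) :
  scomp (spi g) (spi f) = spi (g \oc f).
Proof.
apply/spi_eq; set g' := srepr _; set f' := srepr _.
have -> : g' \oc f' - g \oc f = (g' - g) \oc f' + g \oc (f' - f).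
  by rewrite compBl compBr addrA subrK.
apply: (@rpredD _ (submod_of (factors_proj_submod X Z))); [apply: factors_proj_l | apply: factors_proj_r].
  by apply/spi_eq; rewrite sreprK.
by apply/spi_eq; rewrite sreprK.
Qed.

Program Definition stable_category : category k :=
  @Category k E shom (fun X => spi (idm X)) scomp _ _ _ _ _.
Next Obligation. by move=> X Y f; rewrite -[f]sreprK scompE comp1m. Qed.
Next Obligation. by move=> X Y f; rewrite -[f]sreprK scompE compm1. Qed.
Next Obligation.
move=> X Y Z W h g f; rewrite -[f]sreprK -[g]sreprK -[h]sreprK.
by rewrite !scompE compA.
Qed.
Next Obligation.
move=> X Y Z f a g h; rewrite -[f]sreprK -[g]sreprK -[h]sreprK.
by rewrite -spi_linear !scompE comp_linear_l spi_linear.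
Qed.
Next Obligation.
move=> X Y Z h a f g; rewrite -[f]sreprK -[g]sreprK -[h]sreprK.
by rewrite -spi_linear !scompE comp_linear_r spi_linear.
Qed.

(* A choice, for every object X, of a conflation X -> I X -> S X with I X
   injective; S is the shift of the stable category. *)
Record hulls := Hulls {
  hullI : E -> E;
  hullS : E -> E;
  hull_i : forall X, hom X (hullI X);
  hull_p : forall X, hom (hullI X) (hullS X);
  hull_conflation : forall X, conflation (hull_i X) (hull_p X);
  hull_injective : forall X, injective_ob (hullI X)
}.

Variable H : hulls.

Definition hull_lift X Y (f : hom X Y) (h : hom (hullS H X) (hullS H Y)) :=
  exists g : hom (hullI H X) (hullI H Y),
    g \oc hull_i H X = hull_i H Y \oc f /\
    h \oc hull_p H X = hull_p H Y \oc g.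

Lemma hull_kernel X : is_kernel (hull_i H X) (hull_p H X).
Proof. exact: (ex_kernel (fr_exact (fr_axioms E)) (hull_conflation H X)).1. Qed.

Lemma hull_cokernel X : is_cokernel (hull_p H X) (hull_i H X).
Proof. exact: (ex_kernel (fr_exact (fr_axioms E)) (hull_conflation H X)).2. Qed.

Lemma hull_inflation X : inflation (hull_i H X).
Proof. by exists (hullS H X), (hull_p H X); exact: hull_conflation. Qed.

Lemma hull_projective X : projective (hullI H X).
Proof. by apply/(fr_proj_inj (fr_axioms E)); exact: hull_injective. Qed.

Lemma hull_lift_exists X Y (f : hom X Y) : exists h, hull_lift f h.
Proof.
have [g gP] := hull_injective (hull_i H Y \oc f) (hull_inflation X).
have [|h [hP _]] := (hull_cokernel X).2 _ (hull_p H Y \oc g).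
  by rewrite -compA gP compA (hull_kernel Y).1 comp0m.
by exists h, g.
Qed.

Lemma hull_lift_linear X Y a (f f' : hom X Y) h h' :
  hull_lift f h -> hull_lift f' h' -> hull_lift (a *: f + f') (a *: h + h').
Proof.
move=> [g [gi gp]] [g' [gi' gp']]; exists (a *: g + g').
by rewrite !compDl !compDr !compZl !compZr gi gi' gp gp'.
Qed.

Lemma hull_lift1 X : hull_lift (idm X) (idm (hullS H X)).
Proof. by exists (idm _); rewrite !comp1m !compm1. Qed.

Lemma hull_liftM X Y Z (f : hom X Y) (f' : hom Y Z) h h' :
  hull_lift f h -> hull_lift f' h' -> hull_lift (f' \oc f) (h' \oc h).
Proof.
move=> [g [gi gp]] [g' [gi' gp']]; exists (g' \oc g).
by rewrite -!compA gi gp !compA gi' gp'.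
Qed.

Lemma hull_lift_proj X Y (f : hom X Y) h :
  hull_lift f h -> f \in @factors_proj X Y ->
  h \in @factors_proj (hullS H X) (hullS H Y).
Proof.
move=> [g [gi gp]] /factors_projP[P [b [a [/(fr_proj_inj (fr_axioms E)) iP fE]]]].
have [a' a'P] := iP _ _ _ a (hull_inflation X).
have [|t [tP _]] := (hull_cokernel X).2 _ (g - hull_i H Y \oc b \oc a').
  by rewrite compBl gi fE -[_ \oc a' \oc _]compA a'P compA subrr.
apply/factors_projP; exists (hullI H Y), (hull_p H Y), t.
split; first exact: hull_projective.
have [|h0 [_ h0U]] := (hull_cokernel X).2 _ (hull_p H Y \oc g).
  by rewrite -compA gi compA (hull_kernel Y).1 comp0m.
rewrite -(h0U _ gp); apply: h0U.
by rewrite -compA tP compBr !compA (hull_kernel Y).1 !comp0m subr0.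
Qed.

Lemma hull_lift_eq X Y (f f' : hom X Y) h h' :
  hull_lift f h -> hull_lift f' h' -> spi f = spi f' -> spi h = spi h'.
Proof.
move=> fh fh' /spi_eq ff'; apply/spi_eq.
rewrite -[h - h']addrC -scaleN1r.
apply: (hull_lift_proj (hull_lift_linear (-1) fh' fh)).
by rewrite scaleN1r addrC.
Qed.

Definition sshift_map X Y (q : shom X Y) : shom (hullS H X) (hullS H Y) :=
  spi (sval (cid (hull_lift_exists (srepr q)))).

Lemma sshift_mapE X Y (f : hom X Y) h :
  hull_lift f h -> sshift_map (spi f) = spi h.
Proof.
move=> fh; rewrite /sshift_map; case: cid => h' /= fh'.
by apply: hull_lift_eq fh' fh _; rewrite sreprK.
Qed.

Program Definition stable_shift : functor stable_category stable_category :=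
  @Functor k stable_category stable_category (hullS H) sshift_map _ _ _.
Next Obligation.
move=> X Y a f g; rewrite -[f]sreprK -[g]sreprK.
have [h fh] := hull_lift_exists (srepr f).
have [h' gh'] := hull_lift_exists (srepr g).
rewrite -spi_linear (sshift_mapE (hull_lift_linear a fh gh')).
by rewrite (sshift_mapE fh) (sshift_mapE gh') spi_linear.
Qed.
Next Obligation. by move=> X; exact: sshift_mapE (hull_lift1 X). Qed.
Next Obligation.
move=> X Y Z g f; rewrite -[f]sreprK -[g]sreprK.
have [h fh] := hull_lift_exists (srepr f).
have [h' gh'] := hull_lift_exists (srepr g).
rewrite [LHS](_ : _ = sshift_map (scomp (spi (srepr g)) (spi (srepr f)))) //.
rewrite scompE (sshift_mapE (hull_liftM fh gh')).
by rewrite (sshift_mapE fh) (sshift_mapE gh') -scompE.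
Qed.

(* The standard triangle of a conflation X -i-> Y -p-> Z has as its third map
   the class of any e : Z -> S X induced by an extension g : Y -> I X of the
   hull X -> I X along i. *)
Definition standard_triangle (X Y Z : stable_category)
    (u : hom X Y) (v : hom Y Z) (w : hom Z (stable_shift X)) :=
  exists (i : @hom k E X Y) (p : @hom k E Y Z)
      (g : @hom k E Y (hullI H X)) (e : @hom k E Z (hullS H X)),
    [/\ conflation i p, g \oc i = hull_i H X, e \oc p = hull_p H X \oc g
      & [/\ u = spi i, v = spi p & w = spi e]].

Definition stable_dist (X Y Z : stable_category)
    (u : hom X Y) (v : hom Y Z) (w : hom Z (stable_shift X)) :=
  exists (X' Y' Z' : stable_category)
      (u' : hom X' Y') (v' : hom Y' Z') (w' : hom Z' (stable_shift X'))
      (a : hom X' X) (b : hom Y' Y) (c : hom Z' Z),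
    [/\ standard_triangle u' v' w',
        [/\ is_iso a, is_iso b & is_iso c]
      & [/\ b \oc u' = u \oc a, c \oc v' = v \oc b
          & fmap stable_shift a \oc w' = w \oc c]].

Definition stable : pretriangulated k :=
  @Pretriangulated k stable_category stable_shift stable_dist.

End Stable.

(* Different choices of hulls give triangle equivalent stable categories. *)
Definition algebraic (k : fieldType) (C : triangulated k) :=
  exists (E : frobenius k) (H : hulls E), triangle_equivalent C (stable H).

Section ClusterTilting.
Variables (k : fieldType) (C : triangulated k).
Implicit Types U V T : set C.

Definition ext1_zero (X Y : C) := forall f : hom X (shift Y), f = 0.

Definition cluster_tilting T :=
  [/\ functorially_finite T,
      T = [set X | forall Y, T Y -> ext1_zero Y X]
    & T = [set X | forall Y, T Y -> ext1_zero X Y]].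

(* [V] is the mutation of [U] at [X]. *)
Definition is_mutation U (X : C) V :=
  [/\ cluster_tilting U, U X /\ indecomposable X, cluster_tilting V, V <> U
    & add_closure [set Y | [/\ U Y, indecomposable Y & ~ isomorphic Y X]] `<=` V].

End ClusterTilting.

(* The full subcategory of the objects isomorphic to some [F U]. *)
Definition iso_image (k : fieldType) (C D : category k) (F : C -> D)
    (U : set C) : set D :=
  [set Y | exists X, U X /\ isomorphic (F X) Y].

(* Main.v *)
Require Import Defs.
From mathcomp Require Import all_boot all_algebra.
From mathcomp Require Import boolp classical_sets functions.
Require Import Defs.

Local Open Scope classical_set_scope.

Set Implicit Arguments.
Unset Strict Implicit.
Unset Printing Implicit Defensive.

Import GRing.Theory.

(** An object [X] of [C] has a right [T]-approximation, whose cocone lies in [T]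
    again; so [X] is the cone of a morphism [f : A -> B] of [T], and [X'] is taken
    to be the cone of the image of [f] under the equivalence of [T] with [T'].
    The map [F] sends [X] to [X']. Every property in the theorem is shown to
    depend only on the morphisms presenting the objects concerned, which is the
    same information on both sides. To treat the two sides alike, [T] is replaced
    by an abstract category [D] with functors to [C] and [C'] that are fully
    faithful, have rigid image and present all objects ([presenting]); the
    relation [matched] says that [X] and [X'] are cones of the same [f].

    A map between cones induces a commutative square in [D], and conversely. The
    square forgets exactly the maps [n] with [n \oc g = 0] for all [g] out of
    objects of [D] and [g \oc n = 0] for all [g] into objects of [D[1]]. These
    [negligible] maps form an ideal of square zero, so
    modulo them [C] and [C'] have the same morphisms between matched objects
    ([corresponds]), while isomorphisms and direct sum decompositions lift
    through the ideal ([matched_isomorphic], [matched_dsum]).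

    The Ext groups involve the shift, which this correspondence does not respect,
    but their vanishing can be read off from the presentations
    ([ext1_zero_cone]): [Ext^1(X, Y)] has a subspace of maps factoring through
    [D[1]], which is computed by homotopy classes of complexes in [D], and by the
    2-Calabi-Yau property the quotient by it is dual to the corresponding
    subspace of [Ext^1(Y, X)].

    It remains to compare functorial finiteness. Right approximations modulo
    negligible maps transfer. They can be corrected to right approximations,
    since a negligible map factors through an object of [D[1]], into which there
    are no nonzero negligible maps ([approximation_of_negligible]). Left
    approximations follow from right ones, for a subcategory which is its own
    Ext-orthogonal ([perp_left_approximation]). Hence cluster-tilting
    subcategories correspond ([compatible_cluster_tilting]), and mutations with
    them: the mutation of [U] at [X] is a cluster-tilting subcategory other than
    [U] that contains the remaining indecomposable objects of [U]. *)

(** * Linear categories and exactness of triangles *)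

Section Functor.
Local Open Scope ring_scope.
Variables (k : fieldType) (C D : category k) (G : functor C D).

Lemma fmapD (X Y : C) (f g : hom X Y) : fmap G (f + g) = fmap G f + fmap G g.
Proof. by have := fmap_linear G 1 f g; rewrite !scale1r. Qed.

Lemma fmap0 (X Y : C) : fmap G (0 : hom X Y) = 0.
Proof. by apply: (addrI (fmap G 0)); rewrite -fmapD !addr0. Qed.

Lemma fmapN (X Y : C) (f : hom X Y) : fmap G (- f) = - fmap G f.
Proof. by apply: (addrI (fmap G f)); rewrite -fmapD !subrr fmap0. Qed.

Lemma fmapB (X Y : C) (f g : hom X Y) : fmap G (f - g) = fmap G f - fmap G g.
Proof. by rewrite fmapD fmapN. Qed.

Lemma fmap_sum n (X Y : C) (f : 'I_n -> hom X Y) :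
  fmap G (\sum_j f j) = \sum_j fmap G (f j).
Proof. exact: (big_morph _ (@fmapD X Y) (@fmap0 X Y)). Qed.

End Functor.

Section Category.
Local Open Scope ring_scope.
Variables (k : fieldType) (C : category k).
Implicit Types X Y Z W : C.

Lemma comp_suml n X Y Z (g : 'I_n -> hom Y Z) (f : hom X Y) :
  (\sum_j g j) \oc f = \sum_j (g j \oc f).
Proof.
have compDf (a b : hom Y Z) : (a + b) \oc f = a \oc f + b \oc f by exact: compDl.
by rewrite (big_morph (fun h => h \oc f) compDf (comp0m _ f)).
Qed.

Lemma comp_sumr n X Y Z (g : hom Y Z) (f : 'I_n -> hom X Y) :
  g \oc (\sum_j f j) = \sum_j (g \oc f j).
Proof. by rewrite (big_morph (comp g) (compDr g) (compm0 _ g)). Qed.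

Lemma isomorphic_refl X : isomorphic X X.
Proof. by exists (idm X), (idm X); rewrite comp1m. Qed.

Lemma isomorphic_sym X Y : isomorphic X Y -> isomorphic Y X.
Proof. by move=> [f [g [gf fg]]]; exists g, f. Qed.

Lemma isomorphic_trans X Y Z :
  isomorphic X Y -> isomorphic Y Z -> isomorphic X Z.
Proof.
move=> [f [f' [f'f ff']]] [g [g' [g'g gg']]]; exists (g \oc f), (f' \oc g').
split; first by rewrite compA -(compA f') g'g compm1.
by rewrite compA -(compA g) ff' compm1.
Qed.

Lemma is_iso1 X : is_iso (idm X).
Proof. by exists (idm X); rewrite comp1m. Qed.

Lemma dsum_iso n (A : 'I_n -> C) X Y :
  isomorphic X Y -> is_dsum A X -> is_dsum A Y.
Proof.
move=> [f [g [gf fg]]] [i [p [pi pi0 ip]]].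
exists (fun j => f \oc i j), (fun j => p j \oc g); split=> [j|j l jl|].
- by rewrite -compA (compA g) gf comp1m.
- by rewrite -compA (compA g) gf comp1m pi0.
- rewrite -[RHS]fg -[in RHS](comp1m g) -ip comp_suml comp_sumr.
  by apply: eq_bigr => j _; rewrite !compA.
Qed.

End Category.

Section DirectSums.
Local Open Scope ring_scope.
Variables (k : fieldType) (C : category k).
Variables (n : nat) (A : 'I_n -> C) (Z : C).
Variables (i : forall j, hom (A j) Z) (p : forall j, hom Z (A j)).
Hypotheses (pi : forall j, p j \oc i j = idm (A j))
  (pi0 : forall j l, j != l -> p j \oc i l = 0)
  (ip : \sum_j (i j \oc p j) = idm Z).

Lemma dsum_proj W (f : forall j, hom W (A j)) l :
  p l \oc (\sum_j (i j \oc f j)) = f l.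
Proof.
rewrite comp_sumr (bigD1 l) //= compA pi comp1m big1 ?addr0 // => j jl.
by rewrite compA pi0 ?comp0m // eq_sym.
Qed.

Lemma dsum_inj W (f : forall j, hom (A j) W) l :
  (\sum_j (f j \oc p j)) \oc i l = f l.
Proof.
rewrite comp_suml (bigD1 l) //= -compA pi compm1 big1 ?addr0 // => j jl.
by rewrite -compA pi0 ?compm0.
Qed.

End DirectSums.

Section Copair.
Local Open Scope ring_scope.

Lemma copair_exists (k : fieldType) (C : category k) (U : set C) :
    additive_category C ->
    (forall n (A : 'I_n -> C) X, is_dsum A X -> (forall j, U (A j)) -> U X) ->
  forall P Q X (f : hom P X) (g : hom Q X), U P -> U Q ->
  exists S (i : hom P S) (j : hom Q S) (m : hom S X),
    [/\ U S, m \oc i = f & m \oc j = g].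
Proof.
move=> add dsumU P Q X f g UP UQ.
pose A (j : 'I_2) : C := if j == ord0 then P else Q.
have [S AS] := add _ A; have [i [p [pi pi0 _]]] := AS.
pose m (j : 'I_2) : hom (A j) X :=
  if j == ord0 as b return hom (if b then P else Q) X then f else g.
exists S, (i ord0), (i ord_max), (\sum_j (m j \oc p j)); split.
- by apply: dsumU AS _ => j; rewrite /A; case: (j == _).
- exact: (dsum_inj pi pi0 m ord0).
- exact: (dsum_inj pi pi0 m ord_max).
Qed.

End Copair.

Section Triangles.
Local Open Scope ring_scope.
Variables (k : fieldType) (C : triangulated k).
Implicit Types X Y Z W : C.
Local Notation "f [1]" := (fmap shift f) (at level 2, format "f [1]").

Lemma shift_full X Y (g : hom (shift X) (shift Y)) :
  exists f : hom X Y, f[1] = g.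
Proof. by have [f [fg _]] := (tr_shift (tri_axioms C)).1 X Y g; exists f. Qed.

Lemma shift_inj X Y (f g : hom X Y) : f[1] = g[1] -> f = g.
Proof.
move=> fg; have [h [_ hU]] := (tr_shift (tri_axioms C)).1 X Y g[1].
by rewrite -(hU f fg) -(hU g erefl).
Qed.

Lemma exists_zero : exists O : C, is_zero O.
Proof.
have A (j : 'I_0) : C by case: j.
have [O [i [p [_ _ ip]]]] := tr_additive (tri_axioms C) A.
by exists O; rewrite /is_zero -ip big_ord0.
Qed.

Lemma dist_rot X Y Z (u : hom X Y) (v : hom Y Z) (w : hom Z (shift X)) :
  dist u v w -> dist v w (- u[1]).
Proof. by move=> uvw; apply: (tr_rotation (tri_axioms C) u v w).1. Qed.

Variables (X Y Z : C) (u : hom X Y) (v : hom Y Z) (w : hom Z (shift X)).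
Hypothesis uvw : dist u v w.

Lemma dist_lift W (g : hom W Y) :
  v \oc g = 0 -> exists h : hom W X, g = u \oc h.
Proof.
have [O zO] := exists_zero => vg.
have idW := dist_rot (tr_identity (tri_axioms C) W zO).
have [|c [_ cP]] := tr_morphism (tri_axioms C) (a := g) (b := 0) idW
  (dist_rot uvw).
  by rewrite vg compm0.
have [h hc] := shift_full c; exists h; apply: shift_inj.
move: cP; rewrite fmap1 compNr compm1 compNl -hc => /oppr_inj ->.
by rewrite fmapM.
Qed.

Lemma dist_comp0 : v \oc u = 0.
Proof.
have [O zO] := exists_zero.
have [|c [cP _]] := tr_morphism (tri_axioms C) (a := idm X) (b := u)
  (tr_identity (tri_axioms C) X zO) uvw; first by rewrite !compm1.
by rewrite -cP compm0.
Qed.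

Lemma dist_extend W (g : hom Y W) :
  g \oc u = 0 -> exists h : hom Z W, g = h \oc v.
Proof.
have [O zO] := exists_zero => gu.
(* Neither rotation of the identity triangle of [W] has the form [0 -> W -> W],
   but the second one has this form for [W[1]]; so [u, v] is shifted too. *)
have idW := dist_rot (dist_rot (tr_identity (tri_axioms C) W zO)).
have uvw1 := dist_rot (dist_rot (dist_rot uvw)).
have [|c [cP _]] := tr_morphism (tri_axioms C) (a := 0) (b := g[1]) uvw1 idW.
  by rewrite compm0 compNr -fmapM gu fmap0 oppr0.
have [h hc] := shift_full c; exists h; apply: shift_inj.
by move: cP; rewrite fmap1 compNr compNl comp1m -hc fmapM => /oppr_inj.
Qed.

End Triangles.

(** * Subcategories that are their own Ext-orthogonal *)

Section ExtOrthogonal.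
Local Open Scope ring_scope.
Variables (k : fieldType) (C : triangulated k).
Implicit Types W X Y Z : C.
Local Notation "f [1]" := (fmap shift f) (at level 2, format "f [1]").

Lemma ext1_zero_summand W X Y :
  is_summand X Y -> ext1_zero W Y -> ext1_zero W X.
Proof.
move=> [i [p pi]] WY f.
by rewrite -(comp1m f) -fmap1 -pi fmapM -compA (WY (i[1] \oc f)) compm0.
Qed.

Lemma ext1_zero_dsum W n (A : 'I_n -> C) X :
  is_dsum A X -> (forall j, ext1_zero W (A j)) -> ext1_zero W X.
Proof.
move=> [i [p [_ _ ip]]] WA f.
rewrite -(comp1m f) -fmap1 -ip fmap_sum.
rewrite comp_suml big1 // => j _.
by rewrite fmapM -compA (WA j ((p j)[1] \oc f)) compm0.
Qed.

Variable U : set C.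
Hypothesis UE : U = [set X | forall Y, U Y -> ext1_zero Y X].

Lemma perpP X : U X <-> forall Y, U Y -> ext1_zero Y X.
Proof. by rewrite [X in X _ <-> _]UE. Qed.

Lemma perp_summand X Y : is_summand X Y -> U Y -> U X.
Proof.
move=> XY /perpP UY; apply/perpP => W UW.
exact: ext1_zero_summand XY (UY W UW).
Qed.

Lemma perp_iso X Y : isomorphic X Y -> U X -> U Y.
Proof. by move=> [f [g [_ fg]]]; apply: perp_summand; exists g, f. Qed.

Lemma perp_dsum n (A : 'I_n -> C) X :
  is_dsum A X -> (forall j, U (A j)) -> U X.
Proof.
move=> AX UA; apply/perpP => W UW.
by apply: ext1_zero_dsum AX _ => j; apply: (perpP _).1 UW.
Qed.

Hypothesis rightU :
  forall X, exists T0 (f : hom T0 X), is_right_approximation U f.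

(** The cocone of a right approximation lies in [U] again: maps from [U]
    to its shift lift to [X], hence to the approximation. *)
Lemma perp_resolution X : exists T1 T0 (f : hom T1 T0) (v : hom T0 X) w,
  [/\ U T1, is_right_approximation U v & dist f v w].
Proof.
have [T0 [t [UT0 tP]]] := rightU X.
have [Z [v [w tvw]]] := tr_cone (tri_axioms C) t.
have [T1 [e [e' [e'e ee']]]] := (tr_shift (tri_axioms C)).2 Z.
have [f fE] := shift_full (- (w \oc e)).
have isoe' : is_iso e' by exists e.
have tvw' : dist t (e' \oc v) (w \oc e).
  apply: (tr_iso (tri_axioms C)) (is_iso1 _) (is_iso1 _) isoe' _ _ _ tvw.
  - by rewrite comp1m compm1.
  - by rewrite compm1.
  - by rewrite fmap1 comp1m -compA ee' compm1.
have ftv : dist f t (e' \oc v).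
  by apply/(tr_rotation (tri_axioms C)); rewrite fE opprK.
exists T1, T0, f, t, (e' \oc v); split=> //.
apply/perpP => Y UY g.
have [|h ->] := dist_lift (dist_rot tvw') (g := g).
  exact: (perpP _).1 UT0 _ UY _.
have [h' ->] := tP _ h UY.
by rewrite compA (dist_comp0 tvw') comp0m.
Qed.

(** In a triangle [T1 -> T0 -> X[1] -> T1[1]] with [T1] and [T0] in [U], the last
    map is the shift of a left approximation of [X]: maps from [X[1]] to [U[1]]
    vanish on [T0]. *)
Lemma perp_left_approximation X :
  exists T0 (f : hom X T0), is_left_approximation U f.
Proof.
have [T1 [T0 [f [v [w [UT1 [UT0 vP] fvw]]]]]] := perp_resolution (shift X).
have [l lw] := shift_full w; exists T1, l; split=> // T2 g UT2.
have [|m mP] := dist_extend (dist_rot fvw) (g := g[1]).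
  exact: (perpP _).1 UT2 _ UT0 _.
have [m' m'm] := shift_full m; exists m'; apply: shift_inj.
by rewrite fmapM m'm lw.
Qed.

End ExtOrthogonal.

Section SerreDuality.
Local Open Scope ring_scope.
Variables (k : fieldType) (C : triangulated k).
Implicit Types A X Y : C.
Local Notation "f [1]" := (fmap shift f) (at level 2, format "f [1]").

(** By nondegeneracy of the Serre pairing, a nonzero [h \oc v : A -> Y[1]] pairs
    nontrivially with some [l[1] : Y[1] -> A[2]]; naturality moves [v] to the
    other side, where it appears as [v[1] \oc l]. *)
Lemma cy_vanish A X Y (v : hom A X) : calabi_yau2 C ->
  (forall l : hom Y (shift A), v[1] \oc l = 0) ->
  forall h : hom X (shift Y), h \oc v = 0.
Proof.
move=> [_ [S [eta [sigma [serre _ [t [[isot natt] _]]]]]]] vl h.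
have [f [_ fU]] := serre_bijective serre (X := A) (Y := shift Y) \0%R.
rewrite -(fU 0); last first.
  move=> l; have := serre_linear serre (X := A) (Y := shift Y) (-1) 0 0 l.
  by rewrite scaler0 addr0 mulN1r addNr.
apply/esym/fU => l /=; rewrite (serre_natural_l serre).
suff -> : fmap S v \oc l = 0 by rewrite linear0.
have [l' l'E] := shift_full (t A \oc l).
have [t' [t't _]] := isot X.
rewrite -(comp1m (fmap S v \oc l)) -t't -compA (compA (t X)) -natt.
by rewrite -compA -l'E /= -fmapM vl fmap0 compm0.
Qed.

Lemma cy_ext1_sym X Y : calabi_yau2 C -> ext1_zero X Y -> ext1_zero Y X.
Proof.
move=> cy XY h; rewrite -(compm1 h); apply: cy_vanish cy _ _ => l.
by rewrite (XY l) compm0.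
Qed.

End SerreDuality.

(** * Presentations by a rigid subcategory *)

Section Presentations.
Local Open Scope ring_scope.
Variables (k : fieldType) (D : category k) (C : triangulated k).
Variable J : functor D C.
Implicit Types (A B : D) (X Y Z : C).
Local Notation "f [1]" := (fmap shift f) (at level 2, format "f [1]").

(** The properties of the inclusion of a cluster-tilting subcategory from which
    the objects of [C] are recovered as cones. *)
Record presenting : Prop := Presenting {
  presenting_full : forall A B (g : hom (J A) (J B)),
    exists f : hom A B, fmap J f = g;
  presenting_faithful : forall A B (f g : hom A B),
    fmap J f = fmap J g -> f = g;
  presenting_rigid : forall A B, ext1_zero (J A) (J B);
  presenting_cone : forall X, exists A B (f : hom A B) (v : hom (J B) X) w,
    dist (fmap J f) v w
}.

Record cone A B (f : hom A B) X := Cone {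
  cin : hom (J B) X;
  cout : hom X (shift (J A));
  cone_dist : dist (fmap J f) cin cout
}.

Definition kills_source X Y (n : hom X Y) :=
  forall A (g : hom (J A) X), n \oc g = 0.

(** The morphisms of [C] that induce the zero map, up to homotopy in each degree,
    between complexes presenting [X] and [Y] (see [realizes_negligible]). *)
Definition negligible X Y (n : hom X Y) :=
  kills_source n /\ forall A (g : hom Y (shift (J A))), g \oc n = 0.

Lemma negligible_compl X Y Z (g : hom Y Z) (n : hom X Y) :
  negligible n -> negligible (g \oc n).
Proof.
move=> [n1 n2]; split=> A h; last by rewrite compA n2.
by rewrite -compA (n1 A h) compm0.
Qed.

Lemma negligible_compr X Y Z (n : hom Y Z) (f : hom X Y) :
  negligible n -> negligible (n \oc f).
Proof.
move=> [n1 n2]; split=> A h; first by rewrite -compA n1.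
by rewrite compA (n2 A h) comp0m.
Qed.

Lemma negligible_sum m X Y (n : 'I_m -> hom X Y) :
  (forall j, negligible (n j)) -> negligible (\sum_j n j).
Proof.
move=> nn; split=> A h.
- by rewrite comp_suml big1 // => j _; rewrite (nn j).1.
- by rewrite comp_sumr big1 // => j _; rewrite (nn j).2.
Qed.

Lemma negligible0 X Y : negligible (0 : hom X Y).
Proof. by split=> A h; rewrite (comp0m, compm0). Qed.

Lemma negligible_dsum m (A : 'I_m -> C) Z (n : hom Z Z)
    (i : forall j, hom (A j) Z) (p : forall j, hom Z (A j)) :
  \sum_j (i j \oc p j) = idm Z ->
  (forall j l, negligible (p j \oc n \oc i l)) -> negligible n.
Proof.
move=> ip nn; rewrite -(compm1 n) -(comp1m (n \oc _)) -ip comp_suml.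
apply: negligible_sum => j; rewrite -compA; apply: negligible_compl.
rewrite !comp_sumr; apply: negligible_sum => l.
by rewrite !compA; apply: negligible_compr.
Qed.

Hypothesis presJ : presenting.

Section Cone.
Variables (A B : D) (f : hom A B) (X : C) (p : cone f X).

Lemma cin_comp : cin p \oc fmap J f = 0.
Proof. exact: dist_comp0 (cone_dist p). Qed.

Lemma shift_cout : (fmap J f)[1] \oc cout p = 0.
Proof.
have := dist_comp0 (dist_rot (dist_rot (cone_dist p))).
by rewrite compNl => /eqP; rewrite oppr_eq0 => /eqP.
Qed.

Lemma cin_factor E (g : hom (J E) X) :
  exists h : hom E B, g = cin p \oc fmap J h.
Proof.
have [|h ->] := dist_lift (dist_rot (cone_dist p)) (g := g).
  exact: presenting_rigid.
by have [h' <-] := presenting_full presJ h; exists h'.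
Qed.

Lemma cout_factor E (g : hom X (shift (J E))) :
  exists h : hom A E, g = (fmap J h)[1] \oc cout p.
Proof.
have [|h ->] := dist_extend (dist_rot (cone_dist p)) (g := g).
  exact: presenting_rigid.
have [h' <-] := shift_full h.
by have [h'' <-] := presenting_full presJ h'; exists h''.
Qed.

Lemma cin_eq0 E (h : hom E B) :
  cin p \oc fmap J h = 0 <-> exists s : hom E A, h = f \oc s.
Proof.
split=> [ph|[s ->]]; last by rewrite fmapM compA cin_comp comp0m.
have [s hE] := dist_lift (cone_dist p) ph.
have [s' sE] := presenting_full presJ s.
by exists s'; apply: (presenting_faithful presJ); rewrite fmapM sE.
Qed.

Lemma cout_eq0 E (h : hom A E) :
  (fmap J h)[1] \oc cout p = 0 <-> exists s : hom B E, h = s \oc f.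
Proof.
split=> [hp|[s ->]]; last by rewrite !fmapM -compA shift_cout compm0.
have [s hE] := dist_extend (dist_rot (dist_rot (cone_dist p))) hp.
have [s' sE] := shift_full (- s).
have [s'' s''E] := presenting_full presJ s'.
exists s''; apply: (presenting_faithful presJ); apply: shift_inj.
by rewrite hE !fmapM s''E sE compNl compNr.
Qed.

Lemma kills_source_factor Y (n : hom X Y) :
  kills_source n -> exists m, n = m \oc cout p.
Proof. by move=> n0; have := dist_extend (dist_rot (cone_dist p)) (n0 B _). Qed.

Lemma kills_target_factor W (n : hom W X) :
  cout p \oc n = 0 -> exists m, n = cin p \oc m.
Proof. by move=> n0; have := dist_lift (dist_rot (cone_dist p)) n0. Qed.

End Cone.

Lemma exists_cone X : exists A B (f : hom A B), inhabited (cone f X).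
Proof.
have [A [B [f [v [w fvw]]]]] := presenting_cone presJ X.
by exists A, B, f; split; exists v w.
Qed.

(** The first map factors through some [J B], on which the second one vanishes. *)
Lemma negligible_sq0 X Y Z (n : hom X Y) (n' : hom Y Z) :
  negligible n -> negligible n' -> n' \oc n = 0.
Proof.
move=> [_ n0] [n'0 _]; have [A [B [f [p]]]] := exists_cone Y.
have [m ->] := kills_target_factor (n0 A (cout p)).
by rewrite compA (n'0 B (cin p)) comp0m.
Qed.

Lemma iso_mod_negligible1 X (f : hom X X) : negligible (f - idm X) -> is_iso f.
Proof.
have: f = idm X + (f - idm X) by rewrite addrC subrK.
move: (f - _) => n -> nn.
have nn0 := negligible_sq0 nn nn.
exists (idm X - n).
rewrite !compDl !compDr !compNl !compNr !comp1m !compm1 nn0 oppr0 !addr0.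
by split; rewrite ?addrK ?subrK.
Qed.

(** Isomorphisms lift along the quotient by an ideal of square zero. *)
Lemma iso_mod_negligible X Y (f : hom X Y) (g : hom Y X) :
  negligible (g \oc f - idm X) -> negligible (f \oc g - idm Y) -> is_iso f.
Proof.
move=> /iso_mod_negligible1[a [agf _]] /iso_mod_negligible1[b [_ fgb]].
have E : a \oc g = g \oc b.
  by rewrite -(compm1 (a \oc g)) -fgb !compA -(compA a g f) agf comp1m.
exists (a \oc g); split; first by rewrite -compA agf.
by rewrite E compA fgb.
Qed.

Section ChainMaps.
Variables (A B : D) (f : hom A B) (X : C) (p : cone f X).
Variables (A' B' : D) (f' : hom A' B') (X' : C) (p' : cone f' X').

(** The two squares of a map of triangles [(a1, a0, phi)] that involve [phi]; the
    remaining one, [a0 \oc f = f' \oc a1], lives in [D]. *)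
Definition realizes (a1 : hom A A') (a0 : hom B B') (phi : hom X X') :=
  phi \oc cin p = cin p' \oc fmap J a0 /\
  (fmap J a1)[1] \oc cout p = cout p' \oc phi.

Lemma realizes_exists (phi : hom X X') :
  exists a1 a0, a0 \oc f = f' \oc a1 /\ realizes a1 a0 phi.
Proof.
have [a0 a0E] := cin_factor p' (phi \oc cin p).
have [c [cE1 cE2]] := tr_morphism (tri_axioms C) (dist_rot (cone_dist p))
  (dist_rot (cone_dist p')) a0E.
have [c' c'E] := shift_full c; have [a1 a1E] := presenting_full presJ c'.
exists a1, a0; split; last by rewrite /realizes a1E c'E.
apply: (presenting_faithful presJ); apply: shift_inj.
move: cE2; rewrite compNl compNr => /oppr_inj.
by rewrite !fmapM a1E c'E.
Qed.

Lemma realizes_fill a1 a0 :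
  a0 \oc f = f' \oc a1 -> exists phi, realizes a1 a0 phi.
Proof.
move=> sq.
have [|phi [phiE1 phiE2]] := tr_morphism (tri_axioms C) (a := fmap J a1)
  (b := fmap J a0) (cone_dist p) (cone_dist p'); first by rewrite -!fmapM sq.
by exists phi.
Qed.

Lemma realizes_kills a1 a0 phi : realizes a1 a0 phi ->
  kills_source phi <-> exists s, a0 = f' \oc s.
Proof.
move=> [E _]; rewrite -(cin_eq0 p') -E; split=> [|phi0] // A1 g.
by have [h ->] := cin_factor p g; rewrite compA phi0 comp0m.
Qed.

(** The two homotopies need not agree: [a1] and [a0] vanish separately up to
    homotopy, which is weaker than [(a1, a0)] being null-homotopic. This is what
    makes a description by negligible maps possible. *)
Lemma realizes_negligible a1 a0 phi : realizes a1 a0 phi ->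
  negligible phi <-> (exists s, a0 = f' \oc s) /\ (exists s, a1 = s \oc f).
Proof.
move=> R; rewrite /negligible (realizes_kills R) -(cout_eq0 p) R.2.
split=> [] [? phi0]; split=> // A1 g.
by have [h ->] := cout_factor p' g; rewrite -compA phi0 compm0.
Qed.

End ChainMaps.

(** With [A] and [A'] in degree -1, a map of complexes from [f] to the shift of
    [f'] is a single map [a : A -> B'], and [b], [s] form a null-homotopy of it. *)
Definition homotopy_ext_zero A B (f : hom A B) A' B' (f' : hom A' B') :=
  forall a : hom A B', exists (b : hom A A') (s : hom B B'),
    a = f' \oc b + s \oc f.

Section Ext.
Variables (A B : D) (f : hom A B) (X : C) (p : cone f X).
Variables (A' B' : D) (f' : hom A' B') (X' : C) (p' : cone f' X').

(** The composite [X -> J A[1] -> J B'[1] -> X'[1]] given by [a] vanishes if and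
    only if [a] is null-homotopic: when it vanishes, [X -> J B'[1]] lifts along
    [f'[1]] to a map [X -> J A'[1]], which comes from some [b : A -> A']. *)
Lemma homotopy_ext_zeroP : homotopy_ext_zero f f' <->
  forall a : hom A B', (cin p')[1] \oc (fmap J a)[1] \oc cout p = 0.
Proof.
split=> ext a.
  have [b [s ->]] := ext a; rewrite !fmapD !fmapM compDr compDl.
  rewrite !compA -(fmapM _ (cin p')) cin_comp fmap0 !comp0m add0r.
  by rewrite -!compA shift_cout !compm0.
have [|y yE] := dist_lift (dist_rot (dist_rot (dist_rot (cone_dist p'))))
  (g := (fmap J a)[1] \oc cout p).
  by rewrite compNl compA ext oppr0.
have [b bE] := cout_factor p y.
have [|s sE] := (cout_eq0 p (a + f' \oc b)).1.
  by rewrite !fmapD !fmapM compDl yE bE compNl -compA addNr.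
by exists (- b), s; rewrite -sE compNr addrCA addNr addr0.
Qed.

End Ext.

(** The maps [X -> X'[1]] that factor through [J A[1]] are the homotopy classes of
    maps from [f] to the shift of [f']; the quotient of [Ext^1(X, X')] by them is,
    by Serre duality, dual to the same space with [f] and [f'] exchanged. *)
Lemma ext1_zero_cone (cy : calabi_yau2 C) A B (f : hom A B) X (p : cone f X)
    A' B' (f' : hom A' B') X' (p' : cone f' X') :
  ext1_zero X X' <-> homotopy_ext_zero f f' /\ homotopy_ext_zero f' f.
Proof.
split=> [ext|[/(homotopy_ext_zeroP p p') e /(homotopy_ext_zeroP p' p) e'] h].
  split; [apply/(homotopy_ext_zeroP p p') | apply/(homotopy_ext_zeroP p' p)].
    by move=> a; apply: ext.
  by move=> a; apply: cy_ext1_sym cy ext _.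
(* The image of [h] in the quotient of [Ext^1] by the maps that vanish on [cin p]. *)
have hp : h \oc cin p = 0.
  apply: cy_vanish cy _ h => l.
  by have [a ->] := cout_factor p' l; rewrite compA.
have [m ->] := dist_extend (dist_rot (cone_dist p)) hp.
have [m' <-] := shift_full m; have [a ->] := cin_factor p' m'.
by rewrite fmapM.
Qed.

Variable U : set C.
Hypothesis dsumU : forall n (A : 'I_n -> C) X,
  is_dsum A X -> (forall j, U (A j)) -> U X.

Definition negligible_approximation X T0 (f : hom T0 X) :=
  U T0 /\ forall T1 (g : hom T1 X), U T1 ->
    exists h, negligible (g - f \oc h).

(** A negligible map [n : T2 -> X] kills the source, so it factors through the
    approximation [J B[1] -> X] coming from a presentation of [X[-1]]. Its lift to
    [J B[1]] factors exactly, not just up to negligible maps, through an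
    approximation [r] of [J B[1]], since only zero is negligible there. *)
Lemma approximation_of_negligible :
  (forall X, exists T0 (f : hom T0 X), negligible_approximation f) ->
  forall X, exists T0 (f : hom T0 X), is_right_approximation U f.
Proof.
move=> approx X; have [T0 [f [UT0 fP]]] := approx X.
have [Y [e [e' [e'e ee']]]] := (tr_shift (tri_axioms C)).2 X.
have [A [B [g [p]]]] := exists_cone Y.
have [T1 [r [UT1 rP]]] := approx (shift (J B)).
pose q := e \oc (cin p)[1] \oc r.
have [S [i [j [m [US mi mj]]]]] :=
  copair_exists (tr_additive (tri_axioms C)) dsumU f q UT0 UT1.
exists S, m; split=> // T2 h UT2.
have [s hs] := fP _ h UT2; set n := h - _ in hs.
have [A2 [B2 [f2 [p2]]]] := exists_cone T2.
have [c nE] := kills_source_factor p2 hs.1.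
have [c' c'E] := shift_full (e' \oc c); have [d dE] := cin_factor p c'.
have [t tn] := rP _ ((fmap J d)[1] \oc cout p2) UT2.
have {}tn : (fmap J d)[1] \oc cout p2 = r \oc t.
  by apply/eqP; rewrite -subr_eq0 -(comp1m (_ - _)) tn.2.
have {}nE : n = q \oc t.
  rewrite nE -(comp1m c) -ee' -(compA e) -c'E dE fmapM.
  by rewrite -!compA tn.
exists (i \oc s + j \oc t).
by rewrite compDr !compA mi mj -nE addrC subrK.
Qed.

End Presentations.

(** * Cones of the same morphism in two triangulated categories *)

Section Comparison.
Local Open Scope ring_scope.
Variables (k : fieldType) (D : category k) (C C' : triangulated k).
Variables (J : functor D C) (J' : functor D C').
Hypotheses (presJ : presenting J) (presJ' : presenting J').

Record matched X X' := Matched {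
  msrc : D; mtgt : D; marr : hom msrc mtgt;
  mleft : cone J marr X; mright : cone J' marr X'
}.

Definition corresponds X X' (m : matched X X') Y Y' (n : matched Y Y')
    (phi : hom X Y) (phi' : hom X' Y') :=
  exists a1 a0, realizes (mleft m) (mleft n) a1 a0 phi /\
                realizes (mright m) (mright n) a1 a0 phi'.

Section Correspondence.
Variables (X : C) (X' : C') (m : matched X X').
Variables (Y : C) (Y' : C') (n : matched Y Y').

Lemma corresponds_exists phi : exists phi', corresponds m n phi phi'.
Proof.
have [a1 [a0 [sq R]]] := realizes_exists presJ (mleft m) (mleft n) phi.
have [phi' R'] := realizes_fill (mright m) (mright n) sq.
by exists phi', a1, a0.
Qed.

Lemma corresponds_negligible phi phi' :
  corresponds m n phi phi' -> negligible J phi -> negligible J' phi'.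
Proof.
move=> [a1 [a0 [R R']]].
by move=> /(realizes_negligible presJ R) /(realizes_negligible presJ' R').
Qed.

Lemma corresponds_sub phi phi' psi psi' :
  corresponds m n phi phi' -> corresponds m n psi psi' ->
  corresponds m n (phi - psi) (phi' - psi').
Proof.
move=> [a1 [a0 [[R1 R2] [R1' R2']]]] [b1 [b0 [[S1 S2] [S1' S2']]]].
exists (a1 - b1), (a0 - b0); split; split.
- by rewrite fmapB compBl compBr R1 S1.
- by rewrite !fmapB compBl compBr R2 S2.
- by rewrite fmapB compBl compBr R1' S1'.
- by rewrite !fmapB compBl compBr R2' S2'.
Qed.

Lemma corresponds0 : corresponds m n 0 0.
Proof.
by exists 0, 0; split; split; rewrite !fmap0 comp0m compm0.
Qed.

Lemma corresponds_add phi phi' psi psi' :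
  corresponds m n phi phi' -> corresponds m n psi psi' ->
  corresponds m n (phi + psi) (phi' + psi').
Proof.
move=> c1 c2; have c3 := corresponds_sub corresponds0 c2.
by have := corresponds_sub c1 c3; rewrite !sub0r !opprK.
Qed.

Lemma corresponds_sum l (phi : 'I_l -> hom X Y) (phi' : 'I_l -> hom X' Y') :
  (forall j, corresponds m n (phi j) (phi' j)) ->
  corresponds m n (\sum_j phi j) (\sum_j phi' j).
Proof.
move=> c; apply: (big_ind2 (corresponds m n)) => //; first exact: corresponds0.
by move=> *; apply: corresponds_add.
Qed.

Lemma corresponds1 : corresponds m m (idm X) (idm X').
Proof.
by exists (idm _), (idm _); split; split; rewrite !fmap1 comp1m compm1.
Qed.

End Correspondence.

Lemma corresponds_comp X X' (m : matched X X') Y Y' (n : matched Y Y')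
    Z Z' (l : matched Z Z') phi phi' psi psi' :
  corresponds m n phi phi' -> corresponds n l psi psi' ->
  corresponds m l (psi \oc phi) (psi' \oc phi').
Proof.
move=> [a1 [a0 [[R1 R2] [R1' R2']]]] [b1 [b0 [[S1 S2] [S1' S2']]]].
exists (b1 \oc a1), (b0 \oc a0); split; split.
- by rewrite fmapM -compA R1 compA S1 compA.
- by rewrite !fmapM -compA R2 compA S2 compA.
- by rewrite fmapM -compA R1' compA S1' compA.
- by rewrite !fmapM -compA R2' compA S2' compA.
Qed.

Lemma corresponds_eq X X' (m : matched X X') Y Y' (n : matched Y Y')
    phi phi' psi psi' :
  corresponds m n phi phi' -> corresponds m n psi psi' -> phi = psi ->
  negligible J' (phi' - psi').
Proof.
move=> c1 c2 E; apply: corresponds_negligible (corresponds_sub c1 c2) _.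
by rewrite E subrr; exact: negligible0.
Qed.

Lemma matched_isomorphic X X' Y Y' :
  matched X X' -> matched Y Y' -> isomorphic X Y -> isomorphic X' Y'.
Proof.
move=> m n [f [g [gf fg]]].
have [f' cf] := corresponds_exists m n f.
have [g' cg] := corresponds_exists n m g.
exists f'; apply: (iso_mod_negligible presJ' (g := g')).
- exact: corresponds_eq (corresponds_comp cf cg) (corresponds1 m) gf.
- exact: corresponds_eq (corresponds_comp cg cf) (corresponds1 n) fg.
Qed.

Lemma matched_zero X X' : matched X X' -> is_zero X -> is_zero X'.
Proof.
move=> m zX; have := corresponds_eq (corresponds1 m) (corresponds0 m m) zX.
rewrite subr0 => n1; rewrite /is_zero -(comp1m (idm X')).
exact: (negligible_sq0 presJ' n1 n1).
Qed.

(** Maps corresponding to the injections and projections of [X] need not satisfy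
    the equations of a direct sum, which hold up to negligible maps only; but they
    induce an isomorphism from a direct sum of the [A' j] to [X']. *)
Lemma matched_dsum l (A : 'I_l -> C) (A' : 'I_l -> C') X X' :
  (forall j, matched (A j) (A' j)) -> matched X X' ->
  is_dsum A X -> is_dsum A' X'.
Proof.
move=> mA m [i [p [pi pi0 ip]]].
have /all_sig[i' ci] j := cid (corresponds_exists (mA j) m (i j)).
have /all_sig[p' cp] j := cid (corresponds_exists m (mA j) (p j)).
have [Z' AZ'] := tr_additive (tri_axioms C') A'.
have [I [P [PI PI0 IP]]] := AZ'.
pose f := \sum_j (i' j \oc P j); pose g := \sum_j (I j \oc p' j).
apply: dsum_iso AZ'; exists f; apply: (iso_mod_negligible presJ' (g := g)).
  apply: (negligible_dsum IP) => j j'.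
  have -> : P j \oc (g \oc f - idm Z') \oc I j' =
            p' j \oc i' j' - P j \oc I j'.
    rewrite compBr compBl compm1 compA (dsum_proj PI PI0).
    by rewrite -compA (dsum_inj PI PI0).
  have [<-|jj'] := eqVneq j j'.
    rewrite PI; have cpi := corresponds_comp (ci j) (cp j).
    exact: (corresponds_eq cpi (corresponds1 _) (pi j)).
  rewrite PI0 //; have cpi := corresponds_comp (ci j') (cp j).
  exact: (corresponds_eq cpi (corresponds0 _ _) (pi0 _ _ jj')).
have -> : f \oc g = \sum_j (i' j \oc p' j).
  rewrite comp_suml; apply: eq_bigr => j _.
  by rewrite -compA (dsum_proj PI PI0).
apply: corresponds_eq (corresponds1 m) ip.
exact: corresponds_sum (fun j => corresponds_comp (cp j) (ci j)).
Qed.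

Lemma matched_ext1 X X' Y Y' : calabi_yau2 C -> calabi_yau2 C' ->
  matched X X' -> matched Y Y' -> ext1_zero X Y -> ext1_zero X' Y'.
Proof.
move=> cy cy' m n /(ext1_zero_cone presJ cy (mleft m) (mleft n)) ext.
exact/(ext1_zero_cone presJ' cy' (mright m) (mright n)).
Qed.

Lemma matched_exists X : exists X', inhabited (matched X X').
Proof.
have [A [B [f [p]]]] := exists_cone presJ X.
have [X' [v [w fvw]]] := tr_cone (tri_axioms C') (fmap J' f).
by exists X'; split; exists A B f => //; exists v w.
Qed.

End Comparison.

Section Transport.
Local Open Scope ring_scope.
Variable k : fieldType.

Definition swap (D : category k) (C C' : triangulated k) (J : functor D C)
    (J' : functor D C') X X' (m : matched J J' X X') : matched J' J X' X :=
  Matched (mright m) (mleft m).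

Lemma matched_exists_source (D : category k) (C C' : triangulated k)
    (J : functor D C) (J' : functor D C') (presJ' : presenting J') X' :
  exists X, inhabited (matched J J' X X').
Proof.
by have [X [m]] := matched_exists J presJ' X'; exists X; split; exact: swap.
Qed.

Variables (D : category k) (C C' : triangulated k).
Variables (J : functor D C) (J' : functor D C').
Hypotheses (presJ : presenting J) (presJ' : presenting J').

Lemma corresponds_swap X X' (m : matched J J' X X') Y Y' (n : matched J J' Y Y')
    phi phi' :
  corresponds (swap m) (swap n) phi' phi -> corresponds m n phi phi'.
Proof. by move=> [a1 [a0 [R R']]]; exists a1, a0. Qed.

Lemma matched_indecomposable X X' :
  matched J J' X X' -> indecomposable X -> indecomposable X'.
Proof.
move=> m [nzX indX]; split=> [zX'|A' dA'].
  exact/nzX/(matched_zero presJ' presJ (swap m)).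
have /all_sig[A mA'] j := cid (matched_exists_source J presJ' (A' j)).
have mA j := inhabited_witness (mA' j).
have dA := matched_dsum presJ' presJ (fun j => swap (mA j)) (swap m) dA'.
have [j zA] := indX A dA.
by exists j; apply: matched_zero presJ presJ' _ _ (mA j) zA.
Qed.

Variables (U : set C) (U' : set C').

Definition compatible := forall X X', matched J J' X X' -> (U X <-> U' X').

Hypothesis compU : compatible.

Lemma matched_approximation X X' : matched J J' X X' ->
  (exists T0 (f : hom T0 X), negligible_approximation J U f) ->
  exists T0 (f : hom T0 X'), negligible_approximation J' U' f.
Proof.
move=> m [T0 [f [UT0 fP]]].
have [T0' [mT0]] := matched_exists J' presJ T0.
have [f' cf] := corresponds_exists presJ mT0 m f.
exists T0', f'; split=> [|T1' g' UT1']; first exact/(compU mT0).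
have [T1 [mT1]] := matched_exists_source J presJ' T1'.
have [g cg] := corresponds_exists presJ' (swap mT1) (swap m) g'.
have [h hP] := fP _ g ((compU mT1).2 UT1').
have [h' ch] := corresponds_exists presJ mT1 mT0 h.
exists h'; apply: (corresponds_negligible presJ presJ') hP.
exact: corresponds_sub (corresponds_swap cg) (corresponds_comp ch cf).
Qed.

Lemma compatible_cluster_tilting : calabi_yau2 C -> calabi_yau2 C' ->
  cluster_tilting U -> cluster_tilting U'.
Proof.
move=> cy cy' [ffU UE UE'].
have U'E : U' = [set X' | forall Y', U' Y' -> ext1_zero Y' X'].
  apply/seteqP; split=> X' /=;
    have [X [m]] := matched_exists_source J presJ' X'.
    move=> /(compU m) /(perpP UE) UX Y' U'Y'.
    have [Y [mY]] := matched_exists_source J presJ' Y'.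
    apply: (matched_ext1 presJ presJ' cy cy' mY m); apply: UX.
    exact/(compU mY).
  move=> U'X; apply/(compU m)/(perpP UE) => Y UY.
  have [Y' [mY]] := matched_exists J' presJ Y.
  apply: (matched_ext1 presJ' presJ cy' cy (swap mY) (swap m)); apply: U'X.
  exact/(compU mY).
have rightU' X' : exists T0 (f : hom T0 X'), is_right_approximation U' f.
  apply: (approximation_of_negligible presJ' (perp_dsum U'E)) => {}X'.
  have [X [m]] := matched_exists_source J presJ' X'.
  apply: matched_approximation m _.
  have [[T0 [f [UT0 fP]]] _] := ffU X.
  exists T0, f; split=> // T1 g UT1; have [h ->] := fP _ g UT1.
  by exists h; rewrite subrr; apply: negligible0.
split=> //.
  by move=> X'; split=> //; apply: perp_left_approximation U'E rightU' X'.
rewrite [LHS]U'E; apply/seteqP; split=> X' /= U'X Y' U'Y'.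
  exact: cy_ext1_sym cy' (U'X _ U'Y').
exact: cy_ext1_sym cy' (U'X _ U'Y').
Qed.

End Transport.

(** * Cluster-tilting subcategories *)

Section Assembly.
Local Open Scope ring_scope.
Variable k : fieldType.
Implicit Type C : triangulated k.

Definition inclusion C (T : set C) : functor (full_sub T) C :=
  @Functor k (full_sub T) C (fun X => sval X) (fun X Y f => f)
    (fun X Y a f g => erefl) (fun X => erefl) (fun X Y Z g f => erefl).

Lemma presenting_inclusion C (T : set C) :
  cluster_tilting T -> presenting (inclusion T).
Proof.
move=> [ffT TE _]; split=> [A B g|//|[A TA] [B TB]|X].
- by exists g.
- exact: (perpP TE _).1 TB _ TA.
- have [A [B [f [v [w [TA [TB _] fvw]]]]]] := perp_resolution TE
    (fun X => (ffT X).1) X.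
  by exists (exist _ A TA), (exist _ B TB), f, v, w.
Qed.

Lemma fmap_iso (C D : category k) (G : functor C D) (X Y : C) (f : hom X Y) :
  is_iso f -> is_iso (fmap G f).
Proof.
by move=> [g [gf fg]]; exists (fmap G g); rewrite -!fmapM gf fg !fmap1.
Qed.

Lemma presenting_comp (D D' : category k) C (G : functor D D')
    (J : functor D' C) :
  is_equivalence G -> presenting J -> presenting (comp_functor J G).
Proof.
move=> [ffG esG] presJ.
split=> [A B g|A B f g /(presenting_faithful presJ) fg|A B|X].
- have [g' <-] := presenting_full presJ g.
  by have [f [<- _]] := ffG _ _ g'; exists f.
- by have [h [_ hU]] := ffG _ _ (fmap G g); rewrite -(hU f fg) -(hU g).
- exact: (presenting_rigid presJ (A := G A) (B := G B)).
- have [A' [B' [f' [v [w fvw]]]]] := presenting_cone presJ X.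
  have [A [e [e' [e'e ee']]]] := esG A'.
  have [B [d [d' [d'd dd']]]] := esG B'.
  have [f [fE _]] := ffG _ _ (d' \oc f' \oc e).
  exists A, B, f, (v \oc fmap J d), (fmap shift (fmap J e') \oc w).
  have isoe : is_iso (fmap J e') by apply: fmap_iso; exists e.
  have isod : is_iso (fmap J d') by apply: fmap_iso; exists d.
  apply: (tr_iso (tri_axioms C)) isoe isod (is_iso1 X) _ _ _ fvw.
  + by rewrite /= fE -!fmapM -!compA ee' compm1.
  + by rewrite comp1m -compA -fmapM dd' fmap1 compm1.
  + by rewrite compm1.
Qed.

Lemma mem_add_closure C (S : set C) X : S X -> add_closure S X.
Proof.
move=> SX; exists 1%N, (fun=> X), X; split=> //.
  exists (fun=> idm X), (fun=> idm X); split=> [j|j l|].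
  - by rewrite comp1m.
  - by rewrite !ord1 eqxx.
  - by rewrite big_ord1 comp1m.
by exists (idm X), (idm X); rewrite comp1m.
Qed.

Lemma cluster_tilting_iso C (U : set C) X Y :
  cluster_tilting U -> isomorphic X Y -> U X -> U Y.
Proof. by move=> [_ UE _]; exact: (perp_iso UE). Qed.

End Assembly.

Unset Implicit Arguments.

Theorem theorem8p7 (k : closedFieldType) (C C' : triangulated k)
    (T : set C) (T' : set C')
    (ksC : krull_schmidt C) (ksC' : krull_schmidt C')
    (algC : algebraic C) (algC' : algebraic C')
    (cyC : calabi_yau2 C) (cyC' : calabi_yau2 C')
    (ctT : cluster_tilting T) (ctT' : cluster_tilting T')
    (dirT : directed (full_sub T)) (dirT' : directed (full_sub T'))
    (eqTT' : equivalent (full_sub T) (full_sub T')) :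
  exists F : C -> C',
    [/\ (forall X Y : C, isomorphic X Y <-> isomorphic (F X) (F Y)) /\
        (forall Y : C', exists X : C, isomorphic (F X) Y),
        set_bij [set U : set C | cluster_tilting U]
          [set V : set C' | cluster_tilting V] (iso_image F)
      & forall (U V : set C) (X : C),
          is_mutation U X V ->
          is_mutation (iso_image F U) (F X) (iso_image F V)].
Proof.
have [G eqG] := eqTT'.
pose J := inclusion T; pose J' := comp_functor (inclusion T') G.
have presJ : presenting J by exact: presenting_inclusion.
have presJ' : presenting J'.
  exact: (presenting_comp eqG (presenting_inclusion ctT')).
have [F mF'] := choice (matched_exists J' presJ).
have mF X := inhabited_witness (mF' X).
have matchedF X X' : matched J J' X X' -> isomorphic (F X) X'.
  move=> m; apply: (matched_isomorphic presJ presJ' (mF X) m).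
  exact: isomorphic_refl.
have isoF X Y : isomorphic X Y <-> isomorphic (F X) (F Y).
  split; first exact: (matched_isomorphic presJ presJ' (mF X) (mF Y)).
  exact: (matched_isomorphic presJ' presJ (swap (mF X)) (swap (mF Y))).
have surjF Y : exists X, isomorphic (F X) Y.
  have [X [m]] := matched_exists_source J presJ' Y.
  by exists X; apply: matchedF.
have compF U : cluster_tilting U -> compatible J J' U (iso_image F U).
  move=> ctU X X' m; split=> [UX|[Y [UY FYX']]].
    by exists X; split; last exact: matchedF.
  apply: cluster_tilting_iso ctU _ UY; apply/isoF.
  by apply: isomorphic_trans FYX' (isomorphic_sym (matchedF _ _ m)).
have ctF U : cluster_tilting U -> cluster_tilting (iso_image F U).
  move=> ctU.
  exact: (compatible_cluster_tilting presJ presJ' (compF U ctU) cyC cyC').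
have injF U V : cluster_tilting U -> cluster_tilting V ->
    iso_image F U = iso_image F V -> U = V.
  move=> ctU ctV UV; apply/seteqP; split=> X.
    by move=> /(compF _ ctU _ _ (mF X)); rewrite UV;
      move=> /(compF _ ctV _ _ (mF X)).
  by move=> /(compF _ ctV _ _ (mF X)); rewrite -UV;
    move=> /(compF _ ctU _ _ (mF X)).
exists F; split=> //.
  split=> [U ctU|U V /set_mem ctU /set_mem ctV|V ctV]; first exact: ctF.
    exact: injF.
  pose U : set C := [set X | V (F X)].
  have VP X X' : isomorphic X X' -> V X -> V X' by exact: cluster_tilting_iso.
  have compV : compatible J' J V U.
    move=> X' X m; have FX := matchedF X X' (swap m).
    by split; apply: VP => //; apply: isomorphic_sym.
  have ctU : cluster_tilting U.
    exact: (compatible_cluster_tilting presJ' presJ compV cyC' cyC ctV).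
  exists U => //; apply/seteqP; split=> Y.
    by move=> [X [VFX XY]]; apply: VP XY VFX.
  move=> VY; have [X XY] := surjF Y; exists X; split=> //.
  by apply: VP VY; apply: isomorphic_sym.
move=> U V X [ctU [UX indX] ctV VU addV].
have [_ V'E _] := ctF V ctV.
split; [exact: ctF| |exact: ctF|by move=> /injF E; apply: VU; apply: E|].
  split; first by exists X; split=> //; apply: isomorphic_refl.
  exact: (matched_indecomposable presJ presJ' (mF X) indX).
move=> Y [n [A [Z [SA AZ YZ]]]].
apply: (perp_summand V'E YZ); apply: (perp_dsum V'E AZ) => j.
have [UA indA nAX] := SA j.
have [B [mB]] := matched_exists_source J presJ' (A j).
apply/(compF V ctV _ _ mB); apply: addV; apply: mem_add_closure; split.
- exact/(compF U ctU _ _ mB).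
- exact: (matched_indecomposable presJ' presJ (swap mB) indA).
- move=> BX; apply: nAX.
  exact: (matched_isomorphic presJ presJ' mB (mF X) BX).
Qed.
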